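(* Consider the semi-discrete oscillation-free discontinuous Galerkin (OFDG) scheme for the one-dimensional shallow water equations described in the context: find $\mathbf{U}_h(\cdot,t)\in[V_h^k]^2$ such that for every cell $I_j$ and every $\mathbf{v}_h\in[V_h^k]^2$, $\int_{I_j}(\mathbf{U}_h)_t\cdot\mathbf{v}_h\,dx=Res_j(\mathbf{U}_h;\mathbf{v}_h)$, where $$\begin{aligned}Res_j(\mathbf{U}_h;\mathbf{v}_h)=&\int_{I_j}\mathbf{F}(\mathbf{U}_h)\cdot(\mathbf{v}_h)_x\,dx-\widehat{\mathbf{F}}^l_{j+\frac12}\cdot(\mathbf{v}_h)^-_{j+\frac12}+\widehat{\mathbf{F}}^r_{j-\frac12}\cdot(\mathbf{v}_h)^+_{j-\frac12}\\&+\int_{I_j}\mathbf{S}(\mathbf{U}_h,b_h)\cdot\mathbf{v}_h\,dx-\sum_{\ell=0}^k\frac{\sigma_j^\ell(\mathbf{U}_h)}{\Delta x_j}\int_{I_j}\big(\widetilde{\mathbf{U}}_h-P_h^{\ell-1}\widetilde{\mathbf{U}}_h\big)\cdot\mathbf{v}_h\,dx.\end{aligned}$$ This scheme is well-balanced for the still water stationary state $hu=0$, $h+b=\text{constant}$. That is, if $\mathbf{U}_h=(h_h,(hu)_h)^T\in[V_h^k]^2$ satisfies $(hu)_h\equiv 0$ and $h_h+b_h\equiv\text{constant}$, then $Res_j(\mathbf{U}_h;\mathbf{v}_h)=0$ for every $j=1,\dots,N$ and every $\mathbf{v}_h\in[V_h^k]^2$.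
   Context: **Equations.** The one-dimensional shallow water equations are $h_t+(hu)_x=0$, $(hu)_t+(hu^2+\frac12gh^2)_x=-ghb_x$, where $h$ is the water height, $u$ the velocity, $b(x)$ the bottom topography and $g>0$ the gravitational constant. Write $\mathbf{U}=(h,hu)^T$, $\mathbf{F}(\mathbf{U})=(hu,\,hu^2+\frac12gh^2)^T$ and $\mathbf{S}(\mathbf{U},b)=(0,-ghb_x)^T$. These are regarded as functions of the conserved variables, with $u=(hu)/h$ for $h>0$; all states considered have $h>0$. **Mesh and spaces.** The domain is partitioned into cells $I_j=[x_{j-\frac12},x_{j+\frac12}]$, $j=1,\dots,N$, with $\Delta x_j=x_{j+\frac12}-x_{j-\frac12}$ and $\Delta x=\max_j\Delta x_j$. For an integer $k\ge1$, $V_h^k=\{v: v|_{I_j}\in P^k(I_j),\ j=1,\dots,N\}$, where $P^k(I_j)$ is the space of polynomials of degree at most $k$ on $I_j$. $w^\pm_{j+\frac12}$ denotes the right/left limit of $w$ at $x_{j+\frac12}$, and $[\![w]\!]_{j+\frac12}=w^+_{j+\frac12}-w^-_{j+\frac12}$. At the two end points of the domain, the exterior traces of $\mathbf{U}_h$ and $b_h$ are supplied by the boundary conditions; the still water condition on $\mathbf{U}_h$ and $b_h$ is understood to hold, with the same constant, for these exterior traces too. $b_h\in V_h^k$ is the $L^2$ projection of $b$, and $\mathbf{S}(\mathbf{U}_h,b_h)=(0,-g h_h(b_h)_x)^T$ in each cell. All integrals are exact. **Numerical fluxes (hydrostatic reconstruction).** At each interface set $$(b_h)^*_{j+\frac12}=\max\big((b_h)^+_{j+\frac12},(b_h)^-_{j+\frac12}\big),\qquad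 (h_h)^{*,\pm}_{j+\frac12}=\max\big(0,\ (h_h+b_h)^\pm_{j+\frac12}-(b_h)^*_{j+\frac12}\big),$$ $$(\mathbf{U}_h)^{*,\pm}_{j+\frac12}=\big((h_h)^{*,\pm}_{j+\frac12},\ ((hu)_h)^\pm_{j+\frac12}\big)^T.$$ Let $\widehat{\mathbf{F}}(\cdot,\cdot)$ be a numerical flux consistent with $\mathbf{F}$, i.e. $\widehat{\mathbf{F}}(\mathbf{U},\mathbf{U})=\mathbf{F}(\mathbf{U})$ (for instance the Lax–Friedrichs flux). Then $$\widehat{\mathbf{F}}^l_{j+\frac12}=\widehat{\mathbf{F}}\big((\mathbf{U}_h)^{*,-}_{j+\frac12},(\mathbf{U}_h)^{*,+}_{j+\frac12}\big)+\Big(0,\ \tfrac g2\big((h_h^2)^-_{j+\frac12}-(h_h^2)^{*,-}_{j+\frac12}\big)\Big)^T,$$ $$\widehat{\mathbf{F}}^r_{j-\frac12}=\widehat{\mathbf{F}}\big((\mathbf{U}_h)^{*,-}_{j-\frac12},(\mathbf{U}_h)^{*,+}_{j-\frac12}\big)+\Big(0,\ \tfrac g2\big((h_h^2)^+_{j-\frac12}-(h_h^2)^{*,+}_{j-\frac12}\big)\Big)^T,$$ where $(h_h^2)^{*,\pm}=((h_h)^{*,\pm})^2$. **Damping term.** $\widetilde{\mathbf{U}}_h=(h_h+b_h,(hu)_h)^T$. For $\ell\ge0$, $P_h^\ell$ is the (componentwise, cellwise) $L^2$ projection: $P_h^\ell\mathbf{w}\in[V_h^\ell]^2$ with $\int_{I_j}(P_h^\ell\mathbf{w}-\mathbf{w})\cdot\mathbf{v}_h\,dx=0$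 for all $\mathbf{v}_h\in[P^\ell(I_j)]^2$; and $P_h^{-1}:=P_h^0$. The damping coefficients are $$\sigma_j^\ell=\frac{2(2\ell+1)}{2k-1}\frac{(\Delta x)^\ell}{\ell!}\max_{s=1,2}\Big([\![\partial_x^\ell V_s]\!]^2_{j-\frac12}+[\![\partial_x^\ell V_s]\!]^2_{j+\frac12}\Big)^{1/2}\ \ge 0,$$ where $(\partial_x^\ell V_1,\partial_x^\ell V_2)^T=\mathbf{R}^{-1}\partial_x^\ell\mathbf{U}_h$, $0\le\ell\le k$. At each interface $\mathbf{R}^{-1}=\begin{pmatrix}c+u&-1\\c-u&1\end{pmatrix}$ with $c=\sqrt{gh}$, evaluated at an average (arithmetic mean or Roe average) of the two traces of $\mathbf{U}_h$ there (it comes from the characteristic decomposition $\mathbf{F}'=\mathbf{R}\Lambda\mathbf{R}^{-1}$ at that average). *)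

(* Defs.v *)
From HB Require Import structures.
From mathcomp Require Import all_boot all_order all_algebra.
From mathcomp Require Import all_classical all_reals all_analysis.

Set Implicit Arguments.
Unset Strict Implicit.
Unset Printing Implicit Defensive.

Import Order.TTheory GRing.Theory Num.Theory.
Import numFieldNormedType.Exports.

Local Open Scope classical_set_scope.
Local Open Scope ring_scope.

Section Vectors.

Definition vec2 {T : Type} (a b : T) : 'cV[T]_2 :=
  \col_i (if i == ord0 then a else b).

Definition height {T : Type} (U : 'cV[T]_2) : T := U ord0 ord0.
Definition discharge {T : Type} (U : 'cV[T]_2) : T := U ord_max ord0.

Definition dot {R : realType} (u v : 'cV[R]_2) : R :=
  \sum_(s < 2) u s ord0 * v s ord0.

Definition evalv {R : realType} (P : 'cV[{poly R}]_2) (y : R) : 'cV[R]_2 :=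
  map_mx (fun p => p.[y]) P.

Definition derivv {R : realType} (l : nat) (P : 'cV[{poly R}]_2) :
    'cV[{poly R}]_2 :=
  map_mx (fun p => p^`(l)) P.

End Vectors.

Section ShallowWater.
Context {R : realType}.
Variable g : R.

Definition velocity (U : 'cV[R]_2) : R := discharge U / height U.

Definition swe_flux (U : 'cV[R]_2) : 'cV[R]_2 :=
  vec2 (discharge U) (height U * velocity U ^+ 2 + g / 2 * height U ^+ 2).

Definition swe_source (U : 'cV[R]_2) (bx : R) : 'cV[R]_2 :=
  vec2 0 (- (g * height U * bx)).

Definition consistent (Fhat : 'cV[R]_2 -> 'cV[R]_2 -> 'cV[R]_2) : Prop :=
  forall U, 0 < height U -> Fhat U U = swe_flux U.

Inductive average := Arithmetic | Roe.

Definition average_state (avg : average) (Um Up : 'cV[R]_2) : 'cV[R]_2 :=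
  match avg with
  | Arithmetic => 2^-1 *: (Um + Up)
  | Roe =>
      let sm := Num.sqrt (height Um) in
      let sp := Num.sqrt (height Up) in
      let h := (height Um + height Up) / 2 in
      vec2 h (h * ((sm * velocity Um + sp * velocity Up) / (sm + sp)))
  end.

(* Rows (c + u, -1) and (c - u, 1). *)
Definition Rinv (U : 'cV[R]_2) : 'M[R]_2 :=
  let c := Num.sqrt (g * height U) in
  let u := velocity U in
  row_mx (vec2 (c + u) (c - u)) (vec2 (- 1) 1) : 'M[R]_(2, 1 + 1).

End ShallowWater.

(* The N cells are indexed by 'I_N and the N + 1 interfaces by 'I_N.+1, both
   from 0.  Since [lift ord_max j] has value j and [lift ord0 j] has value
   j + 1, these are the left and right interfaces of cell j. *)
Section Mesh.
Context {R : realType} {N : nat}.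
Variable x : 'I_N.+1 -> R.

Definition ifaceL (j : 'I_N) : 'I_N.+1 := lift ord_max j.
Definition ifaceR (j : 'I_N) : 'I_N.+1 := lift ord0 j.

Definition is_mesh : Prop := forall j, x (ifaceL j) < x (ifaceR j).

Definition cell (j : 'I_N) : set R := `[x (ifaceL j), x (ifaceR j)].

Definition cell_size (j : 'I_N) : R := x (ifaceR j) - x (ifaceL j).

Definition mesh_size : R := \big[Num.max/0]_(j < N) cell_size j.

Definition cell_int (j : 'I_N) (f : R -> R) : R :=
  \int[lebesgue_measure]_(y in cell j) f y.

(* An element of V_h^k is given by one polynomial per cell. *)
Definition in_Vh (k : nat) (w : 'I_N -> {poly R}) : Prop :=
  forall j, (size (w j) <= k.+1)%N.

Definition in_Vh2 (k : nat) (W : 'I_N -> 'cV[{poly R}]_2) : Prop :=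
  forall s, in_Vh k (fun j => W j s ord0).

Definition square_integrable_on_cells (f : R -> R) : Prop :=
  forall j, measurable_fun (cell j) f /\
    lebesgue_measure.-integrable (cell j) (fun y => (f y ^+ 2)%:E).

Definition is_L2proj (j : 'I_N) (l : nat) (w : R -> R) (p : {poly R}) : Prop :=
  (size p <= l.+1)%N /\
  forall q : {poly R}, (size q <= l.+1)%N ->
    cell_int j (fun y => (p.[y] - w y) * q.[y]) = 0.

(* The projection as an operator; 0 if no polynomial satisfies [is_L2proj],
   which does not happen for square-integrable [w]. *)
Definition L2proj (j : 'I_N) (l : nat) (w : R -> R) : {poly R} :=
  xget 0 [set p | is_L2proj j l w p].

Definition L2projv (j : 'I_N) (l : nat) (W : 'cV[{poly R}]_2) :
    'cV[{poly R}]_2 :=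
  map_mx (fun p => L2proj j l (fun y => p.[y])) W.

(* Left limit at interface i: the value from the cell to its left, or the
   exterior value at the left end point of the domain. *)
Definition left_limit {T : Type} (ext : T) (val : 'I_N -> T) (i : 'I_N.+1) : T :=
  if unlift ord0 i is Some j then val j else ext.

Definition right_limit {T : Type} (ext : T) (val : 'I_N -> T) (i : 'I_N.+1) : T :=
  if unlift ord_max i is Some j then val j else ext.

End Mesh.

Section Scheme.
Context {R : realType} {N : nat}.
Variables (g : R) (x : 'I_N.+1 -> R) (k : nat) (avg : average).
Variable Fhat : 'cV[R]_2 -> 'cV[R]_2 -> 'cV[R]_2.
(* [extL l] and [extR l] are the exterior traces of the l-th derivative of U
   at the two end points of the domain, [bL] and [bR] those of b. *)
Variables (b : 'I_N -> {poly R}) (bL bR : R).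
Variables (U : 'I_N -> 'cV[{poly R}]_2) (extL extR : nat -> 'cV[R]_2).

Definition dUm (l : nat) (i : 'I_N.+1) : 'cV[R]_2 :=
  left_limit (extL l) (fun j => evalv (derivv l (U j)) (x i)) i.
Definition dUp (l : nat) (i : 'I_N.+1) : 'cV[R]_2 :=
  right_limit (extR l) (fun j => evalv (derivv l (U j)) (x i)) i.

Definition Um : 'I_N.+1 -> 'cV[R]_2 := dUm 0.
Definition Up : 'I_N.+1 -> 'cV[R]_2 := dUp 0.

Definition bm (i : 'I_N.+1) : R := left_limit bL (fun j => (b j).[x i]) i.
Definition bp (i : 'I_N.+1) : R := right_limit bR (fun j => (b j).[x i]) i.

Definition bstar (i : 'I_N.+1) : R := Num.max (bp i) (bm i).

Definition hstar_m (i : 'I_N.+1) : R :=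
  Num.max 0 (height (Um i) + bm i - bstar i).
Definition hstar_p (i : 'I_N.+1) : R :=
  Num.max 0 (height (Up i) + bp i - bstar i).

Definition Ustar_m (i : 'I_N.+1) : 'cV[R]_2 :=
  vec2 (hstar_m i) (discharge (Um i)).
Definition Ustar_p (i : 'I_N.+1) : 'cV[R]_2 :=
  vec2 (hstar_p i) (discharge (Up i)).

Definition flux_l (i : 'I_N.+1) : 'cV[R]_2 :=
  Fhat (Ustar_m i) (Ustar_p i) +
  vec2 0 (g / 2 * (height (Um i) ^+ 2 - hstar_m i ^+ 2)).

Definition flux_r (i : 'I_N.+1) : 'cV[R]_2 :=
  Fhat (Ustar_m i) (Ustar_p i) +
  vec2 0 (g / 2 * (height (Up i) ^+ 2 - hstar_p i ^+ 2)).

Definition Utilde (j : 'I_N) : 'cV[{poly R}]_2 :=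
  vec2 (height (U j) + b j) (discharge (U j)).

Definition char_jump (l : nat) (i : 'I_N.+1) : 'cV[R]_2 :=
  let Ri := Rinv g (average_state avg (Um i) (Up i)) in
  Ri *m dUp l i - Ri *m dUm l i.

Definition sigma (j : 'I_N) (l : nat) : R :=
  2 * (2 * l%:R + 1) / (2 * k%:R - 1) * (mesh_size x ^+ l / (l`!)%:R) *
  \big[Num.max/0]_(s < 2)
     Num.sqrt (char_jump l (ifaceL j) s ord0 ^+ 2 +
               char_jump l (ifaceR j) s ord0 ^+ 2).

(* [l.-1] is the truncated predecessor, so that P^{-1} is P^0. *)
Definition damping (j : 'I_N) (v : 'cV[{poly R}]_2) : R :=
  \sum_(l < k.+1) sigma j l / cell_size x j *
    cell_int x j (fun y =>
      dot (evalv (Utilde j - L2projv x j l.-1 (Utilde j)) y) (evalv v y)).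

Definition Res (j : 'I_N) (v : 'I_N -> 'cV[{poly R}]_2) : R :=
    cell_int x j (fun y =>
      dot (swe_flux g (evalv (U j) y)) (evalv (derivv 1 (v j)) y))
  - dot (flux_l (ifaceR j)) (evalv (v j) (x (ifaceR j)))
  + dot (flux_r (ifaceL j)) (evalv (v j) (x (ifaceL j)))
  + cell_int x j (fun y =>
      dot (swe_source g (evalv (U j) y) (b j)^`().[y]) (evalv (v j) y))
  - damping j (v j).

End Scheme.

(* Main.v *)
Require Import Defs.
From HB Require Import structures.
From mathcomp Require Import all_boot all_order all_algebra.
From mathcomp Require Import all_classical all_reals all_analysis.
From mathcomp Require Import ring.

Set Implicit Arguments.
Unset Strict Implicit.
Unset Printing Implicit Defensive.

Import Order.TTheory GRing.Theory Num.Theory.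
Import numFieldNormedType.Exports.

(* At still water both reconstructed heights at an interface equal
   C - max(b^+, b^-) = min(h^+, h^-) > 0, so consistency and u = 0 reduce the
   fluxes of cell j to (0, g/2 h^2), with h the trace from inside the cell.  As
   b_x = - h_x there, the volume and source integrals add up to the integral of
   the derivative of g/2 h^2 v_2 and cancel these fluxes.  The damping term
   vanishes because Utilde = (C, 0) is fixed by every L2 projection. *)

Local Open Scope classical_set_scope.
Local Open Scope ring_scope.

(** * Integration and vanishing of real polynomials on an interval *)

Section Polynomials.
Context {R : realType}.
Implicit Types (p q : {poly R}) (a b : R).

(** At [i = 0] the coefficient is a division by zero, hence 0, so this is the antiderivative that
    vanishes at the origin. *)
Definition antideriv p : {poly R} := \poly_(i < (size p).+1) (p`_i.-1 / i%:R).

Lemma deriv_antideriv p : (antideriv p)^`() = p.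
Proof.
apply/polyP => i; rewrite coef_deriv coef_poly ltnS.
have [ilt|ige] := ltnP i (size p).
  by rewrite -[LHS]mulr_natr /= divfK// pnatr_eq0.
by rewrite mul0rn nth_default.
Qed.

Lemma Rintegral_deriv_poly p a b : a < b ->
  \int[lebesgue_measure]_(y in `[a, b]) p^`().[y] = p.[b] - p.[a].
Proof.
move=> ab; rewrite /Rintegral (@continuous_FTC2 _ (horner p^`()) (horner p))//.
- by apply: continuous_subspaceT => y; exact: continuous_horner.
- split.
  + by move=> y _; exact: derivable_horner.
  + by apply: cvg_at_right_filter; exact: continuous_horner.
  + by apply: cvg_at_left_filter; exact: continuous_horner.
- by move=> y _; rewrite derivE.
Qed.

(** Every polynomial is a derivative, so additivity becomes an identity between end point values and
    no integrability has to be checked. *)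
Lemma Rintegral_polyD p q a b : a < b ->
  \int[lebesgue_measure]_(y in `[a, b]) p.[y] +
  \int[lebesgue_measure]_(y in `[a, b]) q.[y] =
  \int[lebesgue_measure]_(y in `[a, b]) (p + q).[y].
Proof.
move=> ab; rewrite -[p]deriv_antideriv -[q]deriv_antideriv -derivD.
by rewrite !Rintegral_deriv_poly// !hornerD; ring.
Qed.

Lemma poly_eq0_itv p a b : a < b -> (forall y, y \in `[a, b] -> p.[y] = 0) ->
  p = 0.
Proof.
move=> ab p0; apply/eqP/negPn/negP => pN0.
(* These are [size p] distinct points of ]a, b], one more than the degree of a nonzero [p] allows as
   roots. *)
pose s := [seq a + (b - a) / i.+1%:R | i <- iota 0 (size p)].
suff : (size s < size p)%N by rewrite size_map size_iota ltnn.
apply: max_poly_roots => //.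
- apply/allP => _ /mapP[i _ ->]; apply/rootP/p0.
  rewrite in_itv/= lerDl divr_ge0 ?subr_ge0 ?(ltW ab)//=.
  rewrite -lerBrDl ler_pdivrMr// ler_peMr ?subr_ge0 ?(ltW ab)//.
  by rewrite ler1n.
- rewrite map_inj_uniq ?iota_uniq// => i j /addrI/mulfI.
  rewrite subr_eq0 gt_eqF// => /(_ isT)/invr_inj/eqP.
  by rewrite eqr_nat => /eqP[].
Qed.

(* The antiderivative P of p^2 is monotone with P(a) = P(b), hence constant on
   [a, b], hence constant. *)
Lemma Rintegral_sqr_poly_eq0 p a b : a < b ->
  \int[lebesgue_measure]_(y in `[a, b]) (p ^+ 2).[y] = 0 -> p = 0.
Proof.
move=> ab; pose P := antideriv (p ^+ 2).
have P_le c d : c <= d -> P.[c] <= P.[d].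
  rewrite le_eqVlt => /predU1P[-> //|cd].
  rewrite -subr_ge0 -Rintegral_deriv_poly// deriv_antideriv.
  by apply: Rintegral_ge0 => y _; rewrite horner_exp sqr_ge0.
rewrite -[p ^+ 2]deriv_antideriv -/P Rintegral_deriv_poly// => /subr0_eq Pab.
have PE : P - P.[a]%:P = 0.
  apply: (poly_eq0_itv ab) => y; rewrite in_itv/= => /andP[ay yb].
  rewrite !hornerE; apply/eqP; rewrite subr_eq0 eq_le -{1}Pab.
  by rewrite !P_le.
have /eqP : p ^+ 2 = 0.
  by rewrite -[LHS]deriv_antideriv -/P (subr0_eq PE) derivC.
by rewrite sqrf_eq0 => /eqP.
Qed.

End Polynomials.

(** * Components of two-vectors, and the flux at zero velocity *)

Section Vectors.
Context {R : realType}.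

Lemma height_vec2 {T : Type} (a b : T) : height (vec2 a b) = a.
Proof. by rewrite /height mxE. Qed.

Lemma discharge_vec2 {T : Type} (a b : T) : discharge (vec2 a b) = b.
Proof. by rewrite /discharge mxE. Qed.

Lemma vec2D (a b c d : R) : vec2 a b + vec2 c d = vec2 (a + c) (b + d).
Proof. by apply/colP => i; rewrite !mxE; case: ifP. Qed.

Lemma dotE (u v : 'cV[R]_2) :
  dot u v = height u * height v + discharge u * discharge v.
Proof.
rewrite /dot big_ord_recl big_ord1 /height /discharge.
by rewrite (_ : lift _ _ = ord_max)//; exact/val_inj.
Qed.

Lemma height_evalv (P : 'cV[{poly R}]_2) y : height (evalv P y) = (height P).[y].
Proof. exact: mxE. Qed.

Lemma discharge_evalv (P : 'cV[{poly R}]_2) y :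
  discharge (evalv P y) = (discharge P).[y].
Proof. exact: mxE. Qed.

Lemma discharge_derivv1 (P : 'cV[{poly R}]_2) :
  discharge (derivv 1 P) = (discharge P)^`().
Proof. by rewrite /discharge mxE derivn1. Qed.

Lemma derivv0 (P : 'cV[{poly R}]_2) : derivv 0 P = P.
Proof. by apply/matrixP => i j; rewrite mxE derivn0. Qed.

Lemma swe_flux_still (g : R) (U : 'cV[R]_2) : discharge U = 0 ->
  swe_flux g U = vec2 0 (g / 2 * height U ^+ 2).
Proof.
by move=> U0; rewrite /swe_flux /velocity U0 mul0r expr0n mulr0 add0r.
Qed.

End Vectors.

(** * Projection of constants and traces at the interfaces of a cell *)

Section Mesh.
Context {R : realType} {N : nat} (x : 'I_N.+1 -> R).
Hypothesis x_mesh : is_mesh x.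

Lemma cell_int_eq0 j (f : R -> R) : (forall y, f y = 0) -> cell_int x j f = 0.
Proof.
move=> f0; rewrite /cell_int (_ : f = cst 0); last exact/funext.
by rewrite Rintegral_cst ?mul0r//; exact: measurable_itv.
Qed.

(** The error of the projection lies in the test space itself; testing against it makes the integral
    of its square vanish. *)
Lemma L2proj_const (j : 'I_N) l (c : R) :
  L2proj x j l (fun y => c%:P.[y]) = c%:P.
Proof.
have size_c : (size (c%:P : {poly R}) <= l.+1)%N.
  by rewrite (leq_trans (size_polyC_leq1 c)).
have [size_p p_proj] : is_L2proj x j l (fun y => c%:P.[y])
    (L2proj x j l (fun y => c%:P.[y])).
  (* The constant is a projection of itself, so [xget] does not fall back on its default value. *)
  apply: xgetPex; exists c%:P; split=> // q _.
  by apply: cell_int_eq0 => y; rewrite subrr mul0r.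
set p := L2proj _ _ _ _ in size_p p_proj *.
apply/subr0_eq; apply: (Rintegral_sqr_poly_eq0 (x_mesh j)).
rewrite -[RHS](p_proj (p - c%:P)).
  by apply: eq_Rintegral => y _; rewrite horner_exp expr2 !hornerE.
by rewrite (leq_trans (size_polyD _ _))// geq_max size_p size_polyN.
Qed.

Lemma left_limit_ifaceR {T : Type} (ext : T) (val : 'I_N -> T) j :
  left_limit ext val (ifaceR j) = val j.
Proof. by rewrite /left_limit liftK. Qed.

Lemma right_limit_ifaceL {T : Type} (ext : T) (val : 'I_N -> T) j :
  right_limit ext val (ifaceL j) = val j.
Proof. by rewrite /right_limit liftK. Qed.

End Mesh.

(** * The terms of the residual at still water *)

Section StillWater.
Context {R : realType} {N : nat}.
Variables (g : R) (x : 'I_N.+1 -> R) (Fhat : 'cV[R]_2 -> 'cV[R]_2 -> 'cV[R]_2).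
Variables (b : 'I_N -> {poly R}) (bL bR : R).
Variables (U : 'I_N -> 'cV[{poly R}]_2) (extL extR : nat -> 'cV[R]_2) (C : R).
Hypothesis x_mesh : is_mesh x.
Hypothesis Fhat_cons : consistent g Fhat.
Hypothesis h_gt0 : forall j y, cell x j y -> 0 < (height (U j)).[y].
Hypotheses (hL_gt0 : 0 < height (extL 0)) (hR_gt0 : 0 < height (extR 0)).
Hypothesis still_hu : forall j, discharge (U j) = 0.
Hypothesis still_hb : forall j, height (U j) + b j = C%:P.
Hypotheses (still_huL : discharge (extL 0) = 0)
  (still_hbL : height (extL 0) + bL = C).
Hypotheses (still_huR : discharge (extR 0) = 0)
  (still_hbR : height (extR 0) + bR = C).

(** Treats interior and exterior traces alike; [c] stands for the trace of the bottom on the same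
    side as [W]. *)
Definition still_state (W : 'cV[R]_2) (c : R) : Prop :=
  [/\ 0 < height W, discharge W = 0 & height W + c = C].

Lemma still_state_evalv j y : cell x j y ->
  still_state (evalv (derivv 0 (U j)) y) (b j).[y].
Proof.
move=> jy; rewrite /still_state derivv0 height_evalv discharge_evalv.
by rewrite still_hu horner0 -hornerD still_hb hornerC; split=> //; exact: h_gt0.
Qed.

Lemma still_state_m i : still_state (Um x U extL i) (bm x b bL i).
Proof.
rewrite /Um /dUm /bm /left_limit; case: unliftP => [j ->|_]; last by split.
by apply: still_state_evalv; rewrite /cell/= in_itv/= lexx ltW// x_mesh.
Qed.

Lemma still_state_p i : still_state (Up x U extR i) (bp x b bR i).
Proof.
rewrite /Up /dUp /bp /right_limit; case: unliftP => [j ->|_]; last by split.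
by apply: still_state_evalv; rewrite /cell/= in_itv/= lexx ltW// x_mesh.
Qed.

Let hstar i := C - bstar x b bL bR i.

(** Positive water height puts both bottom traces below [C], so their maximum is below [C] too and
    the cut-off at 0 in the reconstruction is inactive. *)
Lemma hstar_still i :
  [/\ 0 < hstar i, hstar_m x b bL bR U extL i = hstar i
     & hstar_p x b bL bR U extR i = hstar i].
Proof.
have [hm_gt0 _ hbm] := still_state_m i; have [hp_gt0 _ hbp] := still_state_p i.
have hs_gt0 : 0 < hstar i.
  by rewrite subr_gt0 gt_max -{1}hbp -hbm !ltrDr hm_gt0 hp_gt0.
by rewrite /hstar_m /hstar_p hbm hbp -/(hstar i) max_r ?ltW.
Qed.

Lemma Fhat_still i :
  Fhat (Ustar_m x b bL bR U extL i) (Ustar_p x b bL bR U extR i) =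
  vec2 0 (g / 2 * hstar i ^+ 2).
Proof.
have [hs_gt0 hm hp] := hstar_still i.
have [_ um _] := still_state_m i; have [_ up _] := still_state_p i.
(* Both arguments are now the same state, and its height is positive as consistency demands. *)
rewrite /Ustar_m /Ustar_p hm hp um up Fhat_cons ?height_vec2//.
by rewrite swe_flux_still ?height_vec2 ?discharge_vec2.
Qed.

(** The correction term trades the reconstructed height in the pressure for the trace from inside
    the cell. *)
Lemma flux_l_still j :
  flux_l g x Fhat b bL bR U extL extR (ifaceR j) =
  vec2 0 (g / 2 * (height (U j)).[x (ifaceR j)] ^+ 2).
Proof.
have [_ hm _] := hstar_still (ifaceR j).
rewrite /flux_l Fhat_still hm vec2D addr0 /Um /dUm left_limit_ifaceR derivv0.
by rewrite height_evalv; congr vec2; ring.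
Qed.

Lemma flux_r_still j :
  flux_r g x Fhat b bL bR U extL extR (ifaceL j) =
  vec2 0 (g / 2 * (height (U j)).[x (ifaceL j)] ^+ 2).
Proof.
have [_ _ hp] := hstar_still (ifaceL j).
rewrite /flux_r Fhat_still hp vec2D addr0 /Up /dUp right_limit_ifaceL derivv0.
by rewrite height_evalv; congr vec2; ring.
Qed.

(* Since b_x = - h_x, the integrand is the derivative of (g / 2) h^2 v_2. *)
Lemma volume_still j (v : 'cV[{poly R}]_2) :
  cell_int x j (fun y =>
    dot (swe_flux g (evalv (U j) y)) (evalv (derivv 1 v) y)) +
  cell_int x j (fun y =>
    dot (swe_source g (evalv (U j) y) (b j)^`().[y]) (evalv v y)) =
  g / 2 * (height (U j)).[x (ifaceR j)] ^+ 2 * (discharge v).[x (ifaceR j)] -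
  g / 2 * (height (U j)).[x (ifaceL j)] ^+ 2 * (discharge v).[x (ifaceL j)].
Proof.
set h := height (U j); set w := discharge v.
have db : (b j)^`() = - h^`().
  by apply/eqP; rewrite -addr_eq0 addrC -derivD still_hb derivC.
have fluxE : cell_int x j (fun y =>
    dot (swe_flux g (evalv (U j) y)) (evalv (derivv 1 v) y)) =
  cell_int x j (horner ((g / 2) *: (h ^+ 2 * w^`()))).
  apply: eq_Rintegral => y _; rewrite swe_flux_still.
    rewrite dotE height_vec2 discharge_vec2 mul0r add0r height_evalv.
    by rewrite discharge_evalv discharge_derivv1 !hornerE.
  by rewrite discharge_evalv still_hu horner0.
have sourceE : cell_int x j (fun y =>
    dot (swe_source g (evalv (U j) y) (b j)^`().[y]) (evalv v y)) =
  cell_int x j (horner (g *: (h * h^`() * w))).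
  apply: eq_Rintegral => y _; rewrite dotE height_vec2 discharge_vec2 mul0r.
  by rewrite add0r db height_evalv discharge_evalv !hornerE mulrN opprK.
rewrite fluxE sourceE /cell_int Rintegral_polyD; last exact: x_mesh.
have -> : (g / 2) *: (h ^+ 2 * w^`()) + g *: (h * h^`() * w) =
    ((g / 2) *: (h ^+ 2 * w))^`().
  rewrite derivZ derivM expr2 derivM scalerDr addrC; congr +%R.
  rewrite [h^`() * h]mulrC -mulr2n mulrnAl -scalerMnr scalerMnl.
  by rewrite -mulr_natr divfK// pnatr_eq0.
rewrite Rintegral_deriv_poly; last exact: x_mesh.
by rewrite !hornerE.
Qed.

Lemma damping_still k avg j (v : 'cV[{poly R}]_2) :
  damping g x k avg b U extL extR j v = 0.
Proof.
rewrite /damping big1// => l _; rewrite [X in _ * X](_ : _ = 0) ?mulr0//.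
have -> : Utilde b U j = vec2 C%:P 0%:P.
  by rewrite /Utilde still_hb still_hu polyC0.
(* Constants belong to the polynomials of every degree bound, including the truncated [l.-1 = 0] at
   [l = 0], so the integrand of each summand is zero. *)
have -> : L2projv x j l.-1 (vec2 C%:P 0%:P) = vec2 C%:P 0%:P.
  by apply/colP => s; rewrite !mxE; case: ifP => _; exact: L2proj_const.
apply: cell_int_eq0 => y; rewrite subrr dotE height_evalv discharge_evalv.
by rewrite /height /discharge !mxE horner0 !mul0r addr0.
Qed.

End StillWater.

Theorem proposition2p1 (R : realType) (g : R) (g_gt0 : 0 < g)
  (N : nat) (x : 'I_N.+1 -> R) (x_mesh : is_mesh x)
  (k : nat) (k_ge1 : (1 <= k)%N) (avg : average)
  (Fhat : 'cV[R]_2 -> 'cV[R]_2 -> 'cV[R]_2) (Fhat_cons : consistent g Fhat)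
  (b : R -> R) (b_L2 : square_integrable_on_cells x b)
  (bh : 'I_N -> {poly R}) (bh_proj : forall j, is_L2proj x j k b (bh j))
  (bL bR : R)
  (U : 'I_N -> 'cV[{poly R}]_2) (U_Vh : in_Vh2 k U)
  (extL extR : nat -> 'cV[R]_2)
  (h_gt0 : forall j y, cell x j y -> 0 < (height (U j)).[y])
  (hL_gt0 : 0 < height (extL 0%N)) (hR_gt0 : 0 < height (extR 0%N))
  (C : R)
  (still_hu : forall j, discharge (U j) = 0)
  (still_hb : forall j, height (U j) + bh j = C%:P)
  (still_huL : discharge (extL 0%N) = 0) (still_hbL : height (extL 0%N) + bL = C)
  (still_huR : discharge (extR 0%N) = 0) (still_hbR : height (extR 0%N) + bR = C) :
  forall (j : 'I_N) (v : 'I_N -> 'cV[{poly R}]_2), in_Vh2 k v ->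
    Res g x k avg Fhat bh bL bR U extL extR j v = 0.
Proof.
move=> j v _; rewrite /Res (damping_still _ _ _ x_mesh still_hu still_hb).
rewrite subr0 (flux_l_still x_mesh Fhat_cons h_gt0 hL_gt0 hR_gt0 still_hu
  still_hb still_huL still_hbL still_huR still_hbR).
rewrite (flux_r_still x_mesh Fhat_cons h_gt0 hL_gt0 hR_gt0 still_hu
  still_hb still_huL still_hbL still_huR still_hbR).
(* Moves the source integral next to the flux integral, so that their sum becomes the difference of
   boundary terms which the interface fluxes cancel. *)
rewrite addrAC [_ - _ + cell_int _ _ _]addrAC.
rewrite (volume_still g x_mesh still_hu still_hb) !dotE !height_vec2.
rewrite !discharge_vec2 !mul0r !add0r !discharge_evalv.
by rewrite [X in X + _]addrAC subrr sub0r addNr.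
Qed.
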